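(* Let $R$ be a ring and $\sigma$ an endomorphism of $R$ with $\sigma(1)=1$. Suppose that for all $a,b\in R$, $a\sigma(b)=0$ implies $ab=0$. Then the following are equivalent: $R$ is abelian; $R[x;\sigma]$ is abelian; $R[[x;\sigma]]$ is abelian.
   Context: Rings are associative with unity. A ring is called abelian if all of its idempotents are central. The skew polynomial ring $R[x;\sigma]$ is the set of polynomials $\sum_{i=0}^n a_ix^i$ with coefficients $a_i\in R$ written on the left, with usual addition and with multiplication determined by $xr=\sigma(r)x$ for all $r\in R$. The skew power series ring $R[[x;\sigma]]$ consists of all power series $\sum_{i=0}^\infty a_ix^i$ ($a_i\in R$), multiplied using the distributive law and the rule $xr=\sigma(r)x$ for all $r\in R$. *)

(* Defs.v *)
From HB Require Import structures.
From mathcomp Require Import all_boot all_order all_algebra.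
From mathcomp Require Import boolp.

Set Implicit Arguments.
Unset Strict Implicit.
Unset Printing Implicit Defensive.

Import GRing.Theory.
Local Open Scope ring_scope.

(* [pzRingType]: the zero ring is not excluded. *)
Definition abelian_ring (S : pzRingType) : Prop :=
  forall e : S, e * e = e -> forall r : S, e * r = r * e.

(* The power series \sum_i a_i x^i, represented by i |-> a_i. It is a record
   because [nat -> R] may carry the pointwise ring structure. *)
Record skew_series (R : pzRingType) (sigma : {rmorphism R -> R}) :=
  SkewSeries { scoef : nat -> R }.

Section SkewSeries.

Variables (R : pzRingType) (sigma : {rmorphism R -> R}).

Local Notation S := (skew_series sigma).
Local Notation mk := (@SkewSeries R sigma).

HB.instance Definition _ := [isNew for @scoef R sigma].
HB.instance Definition _ := [Choice of S by <:].

Lemma skew_seriesP (f g : S) : scoef f =1 scoef g -> f = g.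
Proof. by case: f g => [f] [g] /= /funext ->. Qed.

Definition sadd (f g : S) : S := mk (fun n => scoef f n + scoef g n).
Definition sopp (f : S) : S := mk (fun n => - scoef f n).
Definition szero : S := mk (fun=> 0).
Definition sone : S := mk (fun n => (n == 0%N)%:R).

(* From (a x^i) (b x^j) = a sigma^i(b) x^(i + j). *)
Definition smul (f g : S) : S :=
  mk (fun n => \sum_(i < n.+1) scoef f i * iter i sigma (scoef g (n - i))).

Lemma iter_rmorph0 i : iter i sigma 0 = 0.
Proof. by elim: i => //= i ->; rewrite rmorph0. Qed.

Lemma iter_rmorph1 i : iter i sigma 1 = 1.
Proof. by elim: i => //= i ->; rewrite rmorph1. Qed.

Lemma iter_rmorphD i a b :
  iter i sigma (a + b) = iter i sigma a + iter i sigma b.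
Proof. by elim: i => //= i ->; rewrite rmorphD. Qed.

Lemma iter_rmorphM i a b :
  iter i sigma (a * b) = iter i sigma a * iter i sigma b.
Proof. by elim: i => //= i ->; rewrite rmorphM. Qed.

Lemma iter_rmorph_sum i n (F : 'I_n -> R) :
  iter i sigma (\sum_j F j) = \sum_j iter i sigma (F j).
Proof. exact: (big_morph _ (iter_rmorphD i) (iter_rmorph0 i)). Qed.

Fact saddA : associative sadd.
Proof. by move=> f g h; apply: skew_seriesP => n /=; rewrite addrA. Qed.

Fact saddC : commutative sadd.
Proof. by move=> f g; apply: skew_seriesP => n /=; rewrite addrC. Qed.

Fact sadd0 : left_id szero sadd.
Proof. by move=> f; apply: skew_seriesP => n /=; rewrite add0r. Qed.

Fact saddN : left_inverse szero sopp sadd.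
Proof. by move=> f; apply: skew_seriesP => n /=; rewrite addNr. Qed.

HB.instance Definition _ := GRing.isZmodule.Build S saddA saddC sadd0 saddN.

Fact smulA : associative smul.
Proof.
move=> f g h; apply: skew_seriesP => n /=.
pose coef3 j i := scoef f j * (iter j sigma (scoef g (i - j)) *
                    iter i sigma (scoef h (n - i))).
transitivity (\sum_(j < n.+1) \sum_(i < n.+1 | (j <= i)%N) coef3 j i).
  apply: eq_bigr => /= j _.
  have jn : (j <= n)%N by rewrite -ltnS.
  rewrite iter_rmorph_sum mulr_sumr.
  rewrite -(big_mkord (fun i => j <= i)%N (coef3 j)).
  have <- : \sum_(j <= i < n.+1) coef3 j i =
            \sum_(0 <= i < n.+1 | (j <= i)%N) coef3 j i.
    by rewrite (big_nat_widenl _ 0%N) //.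
  rewrite -[X in (\sum_(X <= i < _) _)%R]add0n big_addn subSn // big_mkord.
  apply: eq_bigr => /= k _; rewrite /coef3 addnK iter_rmorphM -iterD.
  by rewrite [(j + k)%N]addnC subnDA subnAC.
rewrite (exchange_big_dep predT) //=; apply: eq_bigr => i _.
have ilt : (i.+1 <= n.+1)%N := ltn_ord i.
rewrite mulr_suml -(big_mkord (fun j => j <= i)%N (coef3 ^~ (nat_of_ord i))).
rewrite (eq_bigl (fun j => (j < i.+1)%N)) // -(big_nat_widen _ _ _ predT) //.
by rewrite big_mkord; apply: eq_bigr => j _; rewrite /coef3 mulrA.
Qed.

Fact smul1l : left_id sone smul.
Proof.
move=> f; apply: skew_seriesP => n /=.
rewrite big_ord_recl /= mul1r subn0 big1 ?addr0 // => i _.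
by rewrite mul0r.
Qed.

Fact smul1r : right_id sone smul.
Proof.
move=> f; apply: skew_seriesP => n /=.
rewrite big_ord_recr /= subnn iter_rmorph1 mulr1 big1 ?add0r // => i _.
by rewrite subn_eq0 leqNgt ltn_ord iter_rmorph0 mulr0.
Qed.

Fact smulDl : left_distributive smul sadd.
Proof.
move=> f g h; apply: skew_seriesP => n /=; rewrite -big_split /=.
by apply: eq_bigr => i _; rewrite mulrDl.
Qed.

Fact smulDr : right_distributive smul sadd.
Proof.
move=> f g h; apply: skew_seriesP => n /=; rewrite -big_split /=.
by apply: eq_bigr => i _; rewrite iter_rmorphD mulrDr.
Qed.

HB.instance Definition _ :=
  GRing.Zmodule_isPzRing.Build S smulA smul1l smul1r smulDl smulDr.

Lemma scoef0 n : scoef (0 : S) n = 0. Proof. by []. Qed.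
Lemma scoef1 n : scoef (1 : S) n = (n == 0%N)%:R. Proof. by []. Qed.
Lemma scoefN (f : S) n : scoef (- f) n = - scoef f n. Proof. by []. Qed.
Lemma scoefD (f g : S) n : scoef (f + g) n = scoef f n + scoef g n.
Proof. by []. Qed.
Lemma scoefM (f g : S) n :
  scoef (f * g) n = \sum_(i < n.+1) scoef f i * iter i sigma (scoef g (n - i)).
Proof. by []. Qed.

Definition sconst (r : R) : S := mk (fun n => if n == 0%N then r else 0).
Definition sX : S := mk (fun n => (n == 1%N)%:R).

Lemma sX_const (r : R) : sX * sconst r = sconst (sigma r) * sX.
Proof.
apply: skew_seriesP => -[|n]; rewrite !scoefM.
  by rewrite !big_ord1 /= mul0r mulr0.
rewrite 2!big_ord_recl big1 => [|i _]; last by rewrite /= mul0r.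
rewrite big_ord_recl big1 => [|i _]; last by rewrite /= mul0r.
rewrite /= mul0r add0r mul1r !addr0 subSS !subn0 eqSS.
by case: n => [|n] /=; rewrite ?mulr1 ?mulr0 ?rmorph0.
Qed.

Lemma scoefMX (f : S) n : scoef (f * sX) n.+1 = scoef f n.
Proof.
rewrite scoefM (bigD1 (Ordinal (leqnSn n.+1))) //= subSnn iter_rmorph1 mulr1.
rewrite big1 ?addr0 // => i /eqP i_neq_n; case: eqP => [ni1|_].
  case: i_neq_n; apply: val_inj => /=; have ilen : (i <= n.+1)%N := ltn_ord i.
  by rewrite -(subKn ilen) ni1 subSS subn0.
by rewrite iter_rmorph0 mulr0.
Qed.

Lemma scoefMX0 (f : S) : scoef (f * sX) 0 = 0.
Proof. by rewrite scoefM big_ord1 /= mulr0. Qed.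

Lemma scoef_monomial (a : R) i n :
  scoef (sconst a * sX ^+ i) n = if n == i then a else 0.
Proof.
elim: i n => [|i IHi] n; first by rewrite expr0 mulr1.
by rewrite exprSr mulrA; case: n => [|n]; rewrite ?scoefMX0 ?scoefMX ?IHi.
Qed.

Definition finitely_supported : pred S :=
  fun f => `[< exists n, forall i, (n <= i)%N -> scoef f i = 0 >].

Fact finitely_supported_subring : subring_closed finitely_supported.
Proof.
split=> [|f g|f g].
- by apply/asboolP; exists 1%N => -[|i].
- move=> /asboolP[m fm] /asboolP[n gn]; apply/asboolP; exists (maxn m n) => i.
  by rewrite geq_max scoefD scoefN => /andP[/fm -> /gn ->]; rewrite subr0.
- move=> /asboolP[m fm] /asboolP[n gn]; apply/asboolP; exists (m + n)%N => i mni.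
  rewrite scoefM big1 // => k _; have [/fm ->|km] := leqP m k.
    by rewrite mul0r.
  rewrite gn ?iter_rmorph0 ?mulr0 //.
  have kni : (k + n <= i)%N by apply: leq_trans mni; rewrite leq_add2r ltnW.
  by rewrite leq_subRL // (leq_trans (leq_addr n k)).
Qed.

HB.instance Definition _ :=
  GRing.isSubringClosed.Build S finitely_supported finitely_supported_subring.

End SkewSeries.

(* R[x; sigma], as the subring of R[[x; sigma]] of the series with finitely
   many nonzero coefficients. *)
Record skew_poly (R : pzRingType) (sigma : {rmorphism R -> R}) := SkewPoly {
  skew_poly_val :> skew_series sigma;
  _ : skew_poly_val \in @finitely_supported R sigma
}.

Section SkewPoly.

Variables (R : pzRingType) (sigma : {rmorphism R -> R}).

HB.instance Definition _ := [isSub for @skew_poly_val R sigma].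
HB.instance Definition _ := [Choice of skew_poly sigma by <:].
HB.instance Definition _ :=
  GRing.SubChoice_isSubPzRing.Build (skew_series sigma)
    (@finitely_supported R sigma) (skew_poly sigma)
    (@finitely_supported_subring R sigma).

Fact sconst_finite (r : R) : sconst sigma r \in @finitely_supported R sigma.
Proof. by apply/asboolP; exists 1%N => -[|i]. Qed.

Fact sX_finite : sX sigma \in @finitely_supported R sigma.
Proof. by apply/asboolP; exists 2%N => -[|[|i]]. Qed.

Definition pconst (r : R) : skew_poly sigma := SkewPoly (sconst_finite r).
Definition pX : skew_poly sigma := SkewPoly sX_finite.

Lemma pX_const (r : R) : pX * pconst r = pconst (sigma r) * pX.
Proof. by apply: val_inj; rewrite !rmorphM; exact: sX_const. Qed.

Lemma skew_polyE (f : skew_poly sigma) :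
  exists n, f = \sum_(i < n) pconst (scoef f i) * pX ^+ i.
Proof.
have /asboolP[n fn] := valP f; exists n; apply/val_inj/skew_seriesP => k.
have scoef_sum (F : 'I_n -> skew_poly sigma) :
    scoef (\sum_(i < n) F i) k = \sum_(i < n) scoef (F i) k.
  by apply: (big_morph (fun g : skew_poly sigma => scoef g k)).
rewrite scoef_sum; under eq_bigr => i _.
  rewrite -[skew_poly_val _]/(val _) rmorphM rmorphXn scoef_monomial; over.
rewrite -big_mkcond /=; have [/fn fk0|ltkn] := leqP n k.
  by rewrite fk0 big1 // => i /eqP <-.
by rewrite (big_pred1 (Ordinal ltkn)) // => i; rewrite eq_sym.
Qed.

End SkewPoly.

(* Main.v *)
Require Import Defs.
From mathcomp Require Import all_boot all_order all_algebra.

Import GRing.Theory.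
Local Open Scope ring_scope.

(** The three rings form a tower R -> R[x; sigma] -> R[[x; sigma]] of injective
    multiplicative maps, and being abelian passes down such maps
    ([abelian_ring_inj]). So it suffices to prove that R[[x; sigma]] is abelian
    when R is.

    The hypothesis on sigma makes every idempotent of R a fixed point of sigma
    ([idempotent_fixed]): apply it to the products (1 - sigma e) sigma e and
    sigma e (1 - sigma e), which are both zero. As a constant series, an
    idempotent of R which is central in R then commutes with all coefficients
    and with x, hence is central in R[[x; sigma]] ([sconst_central]).

    Finally, let f be an idempotent series with constant term e. Then e is an
    idempotent of R, so it is central in R[[x; sigma]] and in particular
    commutes with f. But commuting idempotent series with the same constant term
    are equal ([idempotent_series_eq]): f (1 - e) and e (1 - f) are idempotents
    without constant term, so both are zero, since a nonzero series without
    constant term has strictly smaller order than its square. Therefore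
    f = f e = e f = e is central. *)

Lemma abelian_ring_inj (S T : pzRingType) (h : S -> T) :
  injective h -> {morph h : x y / x * y} -> abelian_ring T -> abelian_ring S.
Proof.
by move=> h_inj hM abT e ee r; apply: h_inj; rewrite !hM abT // -hM ee.
Qed.

Section IdempotentSeries.

Local Set Implicit Arguments.

Variables (R : pzRingType) (sigma : {rmorphism R -> R}).
Local Notation S := (skew_series sigma).
Local Notation sconst := (@sconst R sigma).

Lemma scoef0M (f g : S) : scoef (f * g) 0 = scoef f 0 * scoef g 0.
Proof. by rewrite scoefM big_ord1. Qed.

Lemma scoef_constM (a : R) (f : S) n : scoef (sconst a * f) n = a * scoef f n.
Proof.
rewrite scoefM big_ord_recl subn0 big1 ?addr0 // => i _.
by rewrite mul0r.
Qed.

Lemma scoefM_const (f : S) (a : R) n :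
  scoef (f * sconst a) n = scoef f n * iter n sigma a.
Proof.
rewrite scoefM big_ord_recr /= subnn big1 ?add0r // => i _.
by rewrite subn_eq0 leqNgt ltn_ord iter_rmorph0 mulr0.
Qed.

Lemma sconstM : {morph sconst : a b / a * b}.
Proof.
move=> a b; apply: skew_seriesP => n; rewrite scoef_constM /=.
by case: n => [|n] //=; rewrite mulr0.
Qed.

Lemma sconst_inj : injective sconst.
Proof. by move=> a b /(congr1 (fun f : S => scoef f 0)). Qed.

Lemma sconst_central (e : R) :
  (forall r, e * r = r * e) -> sigma e = e ->
  forall f : S, sconst e * f = f * sconst e.
Proof.
move=> eC se f; apply: skew_seriesP => n.
by rewrite scoef_constM scoefM_const iter_fix.
Qed.

(** If all coefficients of g below n vanish, then so does coefficient n of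
    g * g = g: each of its terms has a factor of index below n. *)
Lemma idempotent_series_eq0 (g : S) : g * g = g -> scoef g 0 = 0 -> g = 0.
Proof.
move=> gg g0; apply: skew_seriesP; elim/ltn_ind => -[_|n IHn]; first exact: g0.
rewrite -gg scoefM big1 // => -[[|i] ilt] _; first by rewrite g0 mul0r.
by rewrite subSS (IHn (n - i)%N) ?ltnS ?leq_subr // iter_rmorph0 mulr0.
Qed.

(** As f and g commute, f - f g = f (1 - g) is again idempotent, and its constant
    term e - e e is zero, where e is the common constant term of f and g. *)
Lemma idempotent_series_absorb (f g : S) :
  f * f = f -> g * g = g -> f * g = g * f -> scoef f 0 = scoef g 0 ->
  f * g = f.
Proof.
move=> ff gg fg f0; apply/esym/subr0_eq; apply: idempotent_series_eq0.
  have fgK : f * g * f = f * g by rewrite fg -mulrA ff.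
  rewrite mulrBr !mulrBl ff mulrA ff fgK.
  by rewrite mulrA fgK -mulrA gg subrr subr0.
have e0 : scoef f 0 * scoef f 0 = scoef f 0 by rewrite -scoef0M ff.
by rewrite scoefD scoefN scoef0M -f0 e0 subrr.
Qed.

Lemma idempotent_series_eq (f g : S) :
  f * f = f -> g * g = g -> f * g = g * f -> scoef f 0 = scoef g 0 -> f = g.
Proof.
move=> ff gg fg f0; rewrite -(idempotent_series_absorb ff gg fg f0) fg.
exact: idempotent_series_absorb.
Qed.

Hypothesis sigmaP : forall a b : R, a * sigma b = 0 -> a * b = 0.

(** The two instances of the hypothesis give e = sigma e * e and
    sigma e = sigma e * e. *)
Lemma idempotent_fixed (e : R) : e * e = e -> sigma e = e.
Proof.
move=> ee; have sese : sigma e * sigma e = sigma e by rewrite -rmorphM ee.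
have /sigmaP : (1 - sigma e) * sigma e = 0 by rewrite mulrBl mul1r sese subrr.
rewrite mulrBl mul1r => /subr0_eq e_see.
have /sigmaP : sigma e * sigma (1 - e) = 0.
  by rewrite rmorphB rmorph1 mulrBr mulr1 sese subrr.
by rewrite mulrBr mulr1 -e_see => /subr0_eq.
Qed.

Lemma abelian_skew_series : abelian_ring R -> abelian_ring S.
Proof.
move=> abR f ff r; set e := scoef f 0.
have ee : e * e = e by rewrite -scoef0M ff.
have eC := sconst_central (abR e ee) (idempotent_fixed ee).
suff -> : f = sconst e by apply: eC.
by apply: idempotent_series_eq; rewrite -?sconstM ?ee ?eC.
Qed.

End IdempotentSeries.

Theorem proposition3p4 (R : pzRingType) (sigma : {rmorphism R -> R})
    (Hsigma : forall a b : R, a * sigma b = 0 -> a * b = 0) :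
  (abelian_ring R <-> abelian_ring (skew_poly sigma)) /\
  (abelian_ring R <-> abelian_ring (skew_series sigma)).
Proof.
have R_S : abelian_ring R -> abelian_ring (skew_series sigma).
  exact: abelian_skew_series.
have S_P : abelian_ring (skew_series sigma) -> abelian_ring (skew_poly sigma).
  by apply: (@abelian_ring_inj _ _ val); [apply: val_inj | apply: rmorphM].
have P_R : abelian_ring (skew_poly sigma) -> abelian_ring R.
  apply: (@abelian_ring_inj _ _ (@pconst R sigma)) => [a b /(congr1 val)|a b].
    exact: sconst_inj.
  by apply: val_inj; rewrite rmorphM; apply: sconstM.
by split; split; auto.
Qed.
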